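(* $BR_9(K_{2,2},K_{4,4})=14$.
   Context: For bipartite graphs $H_1,H_2$ and a positive integer $m$, $BR_m(H_1,H_2)$ is the least positive integer $n$ such that for every subgraph $G$ of $K_{m,n}$ (parts of sizes $m$ and $n$), either $G$ contains a copy of $H_1$ or the bipartite complement $\overline{G}=K_{m,n}-E(G)$ contains a copy of $H_2$. *)

(* Defs.v *)
From mathcomp Require Import all_boot.

Set Implicit Arguments.
Unset Strict Implicit.
Unset Printing Implicit Defensive.

Record sgraph (V : finType) := SGraph {
  adj :> rel V;
  adj_sym : symmetric adj;
  adj_irr : irreflexive adj }.

Definition Kbip_rel (m n : nat) : rel ('I_m + 'I_n) := fun x y =>
  match x, y with
  | inl _, inr _ | inr _, inl _ => true
  | _, _ => false
  end.

Lemma Kbip_sym m n : symmetric (@Kbip_rel m n).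
Proof. by case=> ? []. Qed.

Lemma Kbip_irr m n : irreflexive (@Kbip_rel m n).
Proof. by case. Qed.

(* The complete bipartite graph K_{m,n}. *)
Definition Kbip (m n : nat) : sgraph ('I_m + 'I_n)%type :=
  SGraph (@Kbip_sym m n) (@Kbip_irr m n).

(* Subgraphs are spanning: G is given by its edges on the vertex set of H. *)
Definition subgraph (V : finType) (G H : sgraph V) : Prop := subrel G H.

Definition edge_diff_rel (V : finType) (H G : sgraph V) : rel V :=
  fun x y => H x y && ~~ G x y.

Lemma edge_diff_sym (V : finType) (H G : sgraph V) :
  symmetric (edge_diff_rel H G).
Proof. by move=> x y; rewrite /edge_diff_rel (adj_sym H) (adj_sym G). Qed.

Lemma edge_diff_irr (V : finType) (H G : sgraph V) :
  irreflexive (edge_diff_rel H G).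
Proof. by move=> x; rewrite /edge_diff_rel (adj_irr H). Qed.

(* H - E(G). *)
Definition edge_diff (V : finType) (H G : sgraph V) : sgraph V :=
  SGraph (edge_diff_sym H G) (edge_diff_irr H G).

Definition bip_complement (m n : nat) (G : sgraph ('I_m + 'I_n)%type) :=
  edge_diff (Kbip m n) G.

(* A copy need not be induced, and it need not respect the sides of a
   bipartite host graph. *)
Definition contains_copy (U V : finType) (G : sgraph V) (H : sgraph U) : Prop :=
  exists f : U -> V, injective f /\ forall x y, H x y -> G (f x) (f y).

Definition BR_arrows (m n : nat) (U1 U2 : finType)
    (H1 : sgraph U1) (H2 : sgraph U2) : Prop :=
  forall G : sgraph ('I_m + 'I_n)%type, subgraph G (Kbip m n) ->
    contains_copy G H1 \/ contains_copy (bip_complement G) H2.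

(* BR_m(H1, H2) = n.  A relation rather than a function, since for small m
   no n may have the arrowing property. *)
Definition BR_eq (m : nat) (U1 U2 : finType)
    (H1 : sgraph U1) (H2 : sgraph U2) (n : nat) : Prop :=
  [/\ 0 < n, BR_arrows m n H1 H2 &
      forall k, 0 < k -> BR_arrows m k H1 H2 -> n <= k].

(* Main.v *)
Require Import Defs.
From mathcomp Require Import all_boot zify.

Set Implicit Arguments.
Unset Strict Implicit.
Unset Printing Implicit Defensive.

(* View G as a 9 x n matrix of zeros and ones: K_{2,2} is a 2 x 2 block of ones
   and a K_{4,4} in the complement is a 4 x 4 block of zeros.

   n <= 13: take nine points of PG(2,3) as rows and its thirteen lines as
   columns.  Two points share one line, and four points miss at most three
   lines.

   n = 14: without a 2 x 2 block of ones there are at most 39 ones.  Reveal the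
   rows by increasing degree, remembering only how many columns have each
   pattern on the revealed rows; this factors out the column permutations.
   Among the remaining rows of least degree reveal one whose vector of
   intersection sizes with the current column classes is lexicographically
   least, which removes most of the row permutations.  Every four rows must miss
   at most three columns, and under this constraint an exhaustive search never
   reaches nine rows. *)

(** * Blocks in matrices and copies of complete bipartite graphs *)

Definition block s (I J : finType) (P : I -> J -> bool) : bool :=
  [exists D : s.-tuple I, exists E : s.-tuple J,
    [&& uniq D, uniq E & all (fun i => all (P i) E) D]].

Lemma blockP s (I J : finType) (P : I -> J -> bool) :
  reflect (exists D : seq I, exists E : seq J,
    [/\ uniq D, uniq E, size D = s, size E = s & {in D & E, forall i j, P i j}])
    (block s P).
Proof.
apply: (iffP existsP) => [[D /existsP[E /and3P[uD uE /allP PDE]]]|[D [E [uD uE sD sE PDE]]]].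
  exists D, E; split; rewrite ?size_tuple // => i j iD jE.
  by have /allP := PDE i iD; apply.
have tD : size D == s by rewrite sD.
have tE : size E == s by rewrite sE.
exists (Tuple tD); apply/existsP; exists (Tuple tE); apply/and3P; split=> //.
by apply/allP => i iD; apply/allP => j jE; apply: PDE.
Qed.

(** Adjacent vertices of [G] lie on opposite sides, so one vertex of a copy fixes the side of all
    the others. If the copy is flipped, the two sides of the pattern exchange roles, which is
    harmless as both have size [s]. *)
Lemma contains_KbipP m n s (G : sgraph ('I_m + 'I_n)%type) :
  0 < s -> subgraph G (Kbip m n) ->
  contains_copy G (Kbip s s) <-> block s (fun i j => G (inl i) (inr j)).
Proof.
case: s => // s _ GK; split; last first.
  case/blockP=> D [E [uD uE sD sE PDE]].
  have [i0 _] : exists i0, i0 \in D.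
    by case: D sD {uD PDE} => // i D _; exists i; rewrite mem_head.
  have [j0 _] : exists j0, j0 \in E.
    by case: E sE {uE PDE} => // j E _; exists j; rewrite mem_head.
  pose f (v : 'I_s.+1 + 'I_s.+1) : 'I_m + 'I_n :=
    match v with inl x => inl (nth i0 D x) | inr y => inr (nth j0 E y) end.
  exists f; split=> [[x|x] [y|y] //= []|[x|x] [y|y] //= _].
  - by move/eqP; rewrite nth_uniq ?sD // => /eqP/val_inj->.
  - by move/eqP; rewrite nth_uniq ?sE // => /eqP/val_inj->.
  - by apply: PDE; rewrite mem_nth ?sD ?sE.
  - by rewrite adj_sym; apply: PDE; rewrite mem_nth ?sD ?sE.
suff sided (g h : 'I_s.+1 -> 'I_m + 'I_n) i0 : injective g -> injective h ->
    (forall x y, G (g x) (h y)) -> g ord0 = inl i0 ->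
    block s.+1 (fun i j => G (inl i) (inr j)).
  case=> f [fI fG]; case f0: (f (inl ord0)) => [i0|j0].
    apply: (sided (f \o inl) (f \o inr) i0) => // [x y /fI[]|x y /fI[]|x y] //.
    exact: fG.
  have := GK _ _ (fG (inl ord0) (inr ord0) isT); rewrite f0.
  case f1: (f (inr ord0)) => [i1|//] _.
  apply: (sided (f \o inr) (f \o inl) i1) => // [x y /fI[]|x y /fI[]|x y] //.
  exact: fG.
move=> gI hI gh g0.
have /fin_all_exists[h' h'E] y : exists j, h y = inr j.
  by have := GK _ _ (gh ord0 y); rewrite g0; case: (h y) => // j _; exists j.
have /fin_all_exists[g' g'E] x : exists i, g x = inl i.
  by have := GK _ _ (gh x ord0); rewrite h'E; case: (g x) => // i _; exists i.
apply/blockP; exists (map g' (enum 'I_s.+1)), (map h' (enum 'I_s.+1)).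
split; rewrite ?size_map -?enumT ?size_enum_ord //.
- by rewrite map_inj_uniq ?enum_uniq // => x y E; apply: gI; rewrite !g'E E.
- by rewrite map_inj_uniq ?enum_uniq // => x y E; apply: hI; rewrite !h'E E.
by move=> _ _ /mapP[x _ ->] /mapP[y _ ->]; rewrite -g'E -h'E.
Qed.

Lemma arrows_block m n s t : 0 < s -> 0 < t ->
  BR_arrows m n (Kbip s s) (Kbip t t) <->
  forall P : 'I_m -> 'I_n -> bool, block s P || block t (fun i j => ~~ P i j).
Proof.
move=> s_gt0 t_gt0.
have sub_compl (G : sgraph ('I_m + 'I_n)%type) :
  subgraph (bip_complement G) (Kbip m n) by move=> x y /andP[].
split=> [arr P|blk G GK].
  pose e : rel ('I_m + 'I_n) := fun x y =>
    match x, y with inl i, inr j | inr j, inl i => P i j | _, _ => false end.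
  have e_sym : symmetric e by move=> [?|?] [?|?].
  have e_irr : irreflexive e by case.
  have eK : subgraph (SGraph e_sym e_irr) (Kbip m n) by move=> [?|?] [?|?].
  apply/orP; case: (arr _ eK).
    by move/(contains_KbipP s_gt0 eK); left.
  by move/(contains_KbipP t_gt0 (sub_compl _)); right.
case/orP: (blk (fun i j => G (inl i) (inr j))) => ?.
  by left; apply/contains_KbipP.
by right; apply/(contains_KbipP t_gt0 (sub_compl G)).
Qed.

Lemma block_inj s (I J I' J' : finType) (g : I -> I') (h : J -> J')
    (P : I' -> J' -> bool) : injective g -> injective h ->
  block s (fun i j => P (g i) (h j)) -> block s P.
Proof.
move=> gI hI /blockP[D [E [uD uE sD sE PDE]]]; apply/blockP.
exists (map g D), (map h E); split; rewrite ?size_map ?map_inj_uniq //.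
by move=> _ _ /mapP[i iD ->] /mapP[j jE ->]; apply: PDE.
Qed.

(** * The search on column classes *)

(* (p, c) stands for c columns with pattern p on the revealed rows; the head of
   p belongs to the row revealed last. *)
Definition blocks := seq (seq bool * nat).

Definition expand (L : blocks) := flatten [seq nseq pc.2 pc.1 | pc <- L].

Definition width (L : blocks) := sumn (unzip2 L).

(** Empty classes are dropped, so the search branches only on patterns that occur. *)
Definition push p c (L : blocks) : blocks := if c is 0 then L else (p, c) :: L.

Fixpoint meets (p q : seq bool) :=
  match p, q with
  | x :: p', y :: q' => if (if x then y else false) then true else meets p' q'
  | _, _ => false
  end.

(* The ways to add a row with at most cap ones, each with its degree.  Columns
   sharing an earlier row cannot both lie in the new one; this also limits a
   single pattern p, as p meets itself unless it is zero.  used lists the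
   patterns from which the new row already takes a column. *)
Fixpoint extensions (L : blocks) (used : seq (seq bool)) cap : seq (nat * blocks) :=
  if L is (p, c) :: L' then
    let lim := if meets p p then if has (meets p) used then 0 else 1 else c in
    [seq (a + dL.1, push (true :: p) a (push (false :: p) (c - a) dL.2))
      | a <- iota 0 (minn lim (minn c cap)).+1,
        dL <- extensions L' (if a is 0 then used else p :: used) (cap - a)]
  else [:: (0, [::])].

Definition forget (L : blocks) : blocks := [seq (behead pc.1, pc.2) | pc <- L].

Definition avoid (L : blocks) : blocks :=
  forget [seq pc <- L | ~~ head true pc.1].

(* Any t of the k revealed rows miss at most three columns of L. *)
Fixpoint missed_le3 k t (L : blocks) : bool :=
  match k, t with
  | _, 0 => width L <= 3
  | 0, _ => true
  | k'.+1, t'.+1 => if missed_le3 k' t' (avoid L) then missed_le3 k' t (forget L) else false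
  end.

Fixpoint lexle (s t : seq nat) :=
  match s, t with
  | x :: s', y :: t' => if x == y then lexle s' t' else x < y
  | [::], _ => true
  | _, _ => false
  end.

(* Intersection sizes of the last row with the classes ps of columns, where ps
   consists of patterns on all but the last r rows. *)
Definition signature (L : blocks) r (ps : seq (seq bool)) : seq nat :=
  [seq width [seq pc <- L | if head false pc.1 then drop r pc.1 == p else false]
    | p <- ps].

(* k rows are revealed, n remain; the last one has degree lo and signature sg
   with respect to the patterns ps on the rows before it.  Nested conditionals
   replace && because call-by-value evaluation computes both of its arguments. *)
Fixpoint search k n lo ps sg budget (L : blocks) : bool :=
  if n is n'.+1 then
    has (fun dL : nat * blocks =>
      let: (d, L') := dL in
      if if lo == d then lexle sg (signature L' 2 ps) else lo < d then
        if missed_le3 k 3 (avoid L') then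
          let ps' := unzip1 L in
          search k.+1 n' d ps' (signature L' 1 ps') (budget - d) L'
        else false
      else false) (extensions L [::] (budget %/ n))
  else true.

(** All 14 columns start in one class, that of the empty pattern. *)
Lemma search_9_14 : search 0 9 0 [::] [::] 39 [:: ([::], 14)] = false.
Proof. vm_cast_no_check (erefl false). Qed.

(** * Expanded class lists and lexicographic order *)

Lemma size_expand L : size (expand L) = width L.
Proof.
rewrite /expand /width size_flatten /shape -map_comp; congr sumn.
by apply: eq_map => -[p c] /=; rewrite size_nseq.
Qed.

Lemma expand_forget L : expand (forget L) = map behead (expand L).
Proof.
rewrite /expand map_flatten -!map_comp; congr flatten.
by apply: eq_map => -[p c] /=; rewrite map_nseq.
Qed.

Lemma expand_filter a L :
  expand [seq pc <- L | a pc.1] = filter a (expand L).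
Proof.
elim: L => //= -[p c] L IH; rewrite /expand /= filter_cat -/(expand L) -IH.
by rewrite filter_nseq; case: (a p); rewrite ?mul1n.
Qed.

Lemma expand_push p c L : expand (push p c L) = nseq c p ++ expand L.
Proof. by case: c. Qed.

(** Serves to reorder the columns so that each class becomes contiguous. *)
Lemma perm_map_exists (T U : eqType) (f : T -> U) s t :
  perm_eq (map f s) t -> exists2 s', perm_eq s' s & map f s' = t.
Proof.
elim: t s => [|y t IH] s st; first by exists s; last exact: perm_nilP.
have /mapP[x xs yE] : y \in map f s by rewrite (perm_mem st) mem_head.
have sE := perm_to_rem xs.
have [|s' s'E <-] := IH (rem x s).
  by rewrite -(perm_cons y) -(permPr st) yE -/(map f (x :: rem x s)) perm_sym perm_map.
by exists (x :: s'); rewrite /= ?yE // (permPr sE) perm_cons.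
Qed.

Lemma lexle_total : total lexle.
Proof.
elim=> [|x s IH] [|y t] //=; rewrite (eq_sym y).
by case: eqP => [_|/eqP]; [exact: IH | rewrite neq_ltn].
Qed.

Lemma lexle_trans : transitive lexle.
Proof.
elim=> [|y t IH] [|x s] [|z u] //=.
case: (eqVneq x y) => [->|xy]; first by case: eqP => // _; apply: IH.
case: (eqVneq y z) => [<-|yz lexy ltyz]; first by rewrite (negPf xy).
have ltxz := ltn_trans lexy ltyz.
by rewrite ltn_eqF.
Qed.

(** * Completeness of the search *)

Section Completeness.

Variables (I J : finType) (P : I -> J -> bool).
Hypothesis no_rectangle : ~~ block 2 P.

Let pat (rows : seq I) j := [seq P i j | i <- rows].
Let deg i := count (P i) (enum J).

Lemma common_column i i' : i != i' -> count (fun j => P i j && P i' j) (enum J) <= 1.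
Proof.
move=> ii'; rewrite leqNgt -size_filter; apply/negP => two.
move/blockP: no_rectangle; apply; exists [:: i; i'].
exists (take 2 [seq j <- enum J | P i j && P i' j]).
split; rewrite /= ?inE ?ii' ?size_takel ?take_uniq ?filter_uniq -?enumT ?enum_uniq //.
move=> x j; rewrite !inE => xD /mem_take; rewrite mem_filter => /andP[/andP[Pij Pi'j] _].
by case/orP: xD => /eqP->.
Qed.

Lemma common_row j j' i i' :
  j != j' -> P i j -> P i j' -> P i' j -> P i' j' -> i = i'.
Proof.
move=> jj' Pij Pij' Pi'j Pi'j'; apply/eqP; apply: contraNT no_rectangle => ii'.
apply/blockP; exists [:: i; i'], [:: j; j']; split; rewrite /= ?inE ?ii' ?jj' //.
by move=> x y; rewrite !inE => /orP[]/eqP-> /orP[]/eqP->.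
Qed.

(* A pair of rows has at most one common column, so the squares of the column
   degrees c sum to at most e + #|I| (#|I| - 1); moreover (c - 2)(c - 3) >= 0. *)
Lemma sum_deg_le : 4 * \sum_i deg i <= #|I| * #|I|.-1 + 6 * #|J|.
Proof.
set e := \sum_i _.
have countE (a : pred J) : count a (enum J) = \sum_j a j.
  by rewrite -sum1_count big_mkcond big_enum; apply: eq_bigr => j _; case: (a j).
pose c j := \sum_i P i j.
have sum_c : \sum_j c j = e.
  by rewrite exchange_big; apply: eq_bigr => i _; rewrite /deg countE.
have sum_c2 : \sum_j c j * c j <= e + #|I| * #|I|.-1.
  have -> : \sum_j c j * c j = \sum_i \sum_i' count (fun j => P i j && P i' j) (enum J).
    under eq_bigr => j _ do rewrite big_distrlr.
    rewrite exchange_big; apply: eq_bigr => i _; rewrite exchange_big.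
    by apply: eq_bigr => i' _; rewrite countE; apply: eq_bigr => j _; rewrite /= mulnb.
  rewrite -sum_nat_const -big_split; apply: leq_sum => i _; rewrite (bigD1 i) //= leq_add //.
    by apply/eq_leq/eq_count => j; rewrite andbb.
  rewrite -(cardC1 i) -sum1_card.
  by apply: leq_sum => i' i'i; apply: common_column; rewrite eq_sym.
have : \sum_j 5 * c j <= \sum_j (c j * c j + 6).
  by apply: leq_sum => j _; case: (c j) => [|[|[|x]]] //; rewrite !mulSn !mulnS; lia.
rewrite -big_distrr big_split /= sum_nat_const sum_c -[X in X * 6]/#|J|.
move: e (\sum_j c j * c j) (#|I| * _) #|J| {sum_c} sum_c2 => e S K n; lia.
Qed.

Lemma meetsP (rows : seq I) j j' :
  reflect (exists i, [/\ i \in rows, P i j & P i j']) (meets (pat rows j) (pat rows j')).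
Proof.
have -> : meets (pat rows j) (pat rows j') = has (fun i => P i j && P i j') rows.
  by elim: rows => //= i rows ->.
apply: (iffP hasP) => [[i iR /andP[Pij Pij']]|[i [iR Pij Pij']]]; exists i => //.
by rewrite Pij.
Qed.

Hypothesis no_hole : ~~ block 4 (fun i j => ~~ P i j).

(** [D] holds the rows already chosen and [js] columns missed by all of them. Once [t] is 0, [D] has
    four rows, and four columns in [js] would form a hole. *)
Lemma missed_le3P rows t L D js :
    uniq (D ++ rows) -> uniq js -> size D + t = 4 ->
    {in D & js, forall i j, ~~ P i j} -> perm_eq (map (pat rows) js) (expand L) ->
  missed_le3 (size rows) t L.
Proof.
elim: rows t L D js => [|i rows IH] [|t] L D js //= uD ujs sD hole Ljs.
1,2: rewrite -size_expand -(perm_size Ljs) size_map leqNgt; apply: contra no_hole => js4;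
  apply/blockP; exists D, (take 4 js);
  split; rewrite ?take_uniq ?size_takel // -?sD ?addn0 //;
    [by move: uD; rewrite cat_uniq => /andP[] | by move=> x j xD /mem_take; apply: hole].
have forgetE (js' : seq J) : map (pat rows) js' = map behead (map (pat (i :: rows)) js').
  by rewrite -map_comp.
have -> : missed_le3 (size rows) t (avoid L).
  apply: (IH _ _ (i :: D) [seq j <- js | ~~ P i j]).
  - by rewrite (uniq_catCA [:: i] D rows).
  - exact: filter_uniq.
  - by rewrite /= addSnnS.
  - move=> x j; rewrite inE mem_filter => /predU1P[->|xD] /andP[Pij jjs] //.
    exact: hole.
  rewrite expand_forget (expand_filter (fun p => ~~ head true p)) forgetE perm_map //.
  have -> : [seq pat (i :: rows) j | j <- [seq j <- js | ~~ P i j]] =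
      [seq p <- map (pat (i :: rows)) js | ~~ head true p] by rewrite filter_map.
  exact: perm_filter.
apply: (IH _ _ D js) => //.
- by apply: subseq_uniq uD; rewrite cat_subseq // subseq_cons.
by rewrite expand_forget forgetE perm_map.
Qed.

(** Row [i] itself selects the branch: [a] is its number of ones in the leading class. The limits on
    [a] hold because two of its columns sharing an earlier row would span a rectangle. *)
Lemma extensionsP rows i L used cap s :
    i \notin rows -> uniq s -> map (pat rows) s = expand L ->
    {in s, forall j, P i j -> ~~ has (meets (pat rows j)) used} ->
    count (P i) s <= cap ->
  exists2 dL, dL \in extensions L used cap &
    dL.1 = count (P i) s /\ perm_eq (map (pat (i :: rows)) s) (expand dL.2).
Proof.
move=> i_rows; elim: L used cap s => [|[p c] L IH] used cap s us sL su scap.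
  by case: s sL us su scap => // _ _ _ _; exists (0, [::]); rewrite ?mem_head.
have [s1 [s2 [sE s1E s2E]]] : exists s1 s2, [/\ s = s1 ++ s2,
    map (pat rows) s1 = nseq c p & map (pat rows) s2 = expand L].
  exists (take c s), (drop c s); rewrite cat_take_drop map_take map_drop sL.
  by rewrite /expand /= take_size_cat ?drop_size_cat ?size_nseq.
rewrite {s}sE in us sL su scap *; rewrite count_cat in scap *.
have c1 : size s1 = c by rewrite -(size_map (pat rows)) s1E size_nseq.
have s1p j : j \in s1 -> pat rows j = p.
  by move=> js1; apply/eqP; have := map_f (pat rows) js1; rewrite s1E mem_nseq => /andP[].
set a := count (P i) s1 in scap *.
have [us1 us2 disj] : [/\ uniq s1, uniq s2 & {in s2, forall j, j \notin s1}].
  by move: us; rewrite cat_uniq => /and3P[us1 /hasPn disj us2].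
have ac : a <= c by rewrite -c1 count_size.
pose used' := if a is 0 then used else p :: used.
have meets_once j j' : P i j -> P i j' -> j != j' -> ~~ meets (pat rows j) (pat rows j').
  move=> Pij Pij' jj'; apply/negP => /meetsP[i' [i'R Pi'j Pi'j']].
  by case/negP: i_rows; rewrite (common_row jj' Pij Pij' Pi'j Pi'j').
have su2 : {in s2, forall j, P i j -> ~~ has (meets (pat rows j)) used'}.
  move=> j js2 Pij; have uj : ~~ has (meets (pat rows j)) used.
    by apply: su; rewrite // mem_cat js2 orbT.
  rewrite /used'; case: (posnP a) => [->//|a_gt0]; rewrite -(prednK a_gt0) /=.
  rewrite negb_or uj andbT.
  have /hasP[j1 j1s1 Pij1] : has (P i) s1 by rewrite has_count.
  rewrite -(s1p _ j1s1) meets_once //; apply: contraNneq (disj _ js2) => -> //.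
have cap2 : count (P i) s2 <= cap - a by rewrite leq_subRL ?(leq_trans _ scap) ?leq_addr.
have [dL dLin [dE LE]] := IH used' (cap - a) s2 us2 s2E su2 cap2.
exists (a + dL.1, push (true :: p) a (push (false :: p) (c - a) dL.2)); last first.
  rewrite /= dE; split=> //; rewrite !expand_push catA map_cat perm_cat //.
  (* Inside the class the columns with a one in row [i] move to the front, as in the order of the
     two pushes. *)
  rewrite perm_sym; apply: (@perm_trans _ (map (pat (i :: rows))
    ([seq j <- s1 | P i j] ++ [seq j <- s1 | ~~ P i j]))); last first.
    exact/perm_map/permEl/perm_filterC.
  have patE (q : pred J) b : (forall j, q j -> P i j = b) ->
      map (pat (i :: rows)) (filter q s1) = nseq (count q s1) (b :: p).
    move=> qb; rewrite -size_filter -(size_map (pat (i :: rows))); apply/all_pred1P.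
    apply/allP => x /mapP[j]; rewrite mem_filter => /andP[qj js1] ->.
    by rewrite /= (qb j qj) -(s1p j js1).
  rewrite map_cat (patE _ true) // (patE _ false) => [|j /negPf//].
  by rewrite -c1 -(count_predC (P i)) -/a addKn.
apply/allpairsPdep; exists a, dL; split=> //; rewrite mem_iota add0n ltnS !leq_min ac.
rewrite (leq_trans (leq_addr _ _) scap) andbT /=.
case pp: (meets p p); last by rewrite ac.
have a_le1 : a <= 1.
  rewrite leqNgt /a -size_filter; apply/negP => two.
  have : uniq [seq j <- s1 | P i j] by rewrite filter_uniq.
  have : all [pred j | P i j && (j \in s1)] [seq j <- s1 | P i j].
    by apply/allP => j; rewrite mem_filter.
  case: {+}[seq j <- s1 | P i j] two => [|j [|j' ?]] //= _.
  case/and3P=> /andP[Pij js1] /andP[Pij' j's1] _; rewrite inE negb_or -andbA => /andP[jj' _].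
  by have := meets_once _ _ Pij Pij' jj'; rewrite (s1p j) // (s1p j') // pp.
case up: (has (meets p) used); last by rewrite a_le1.
rewrite leqNgt /a -has_count andbT; apply/hasPn => j js1; apply/negP => Pij.
by have := su j; rewrite mem_cat js1 (s1p j js1) up => /(_ isT Pij).
Qed.

Let key rows ps i :=
  [seq count (fun j => P i j && (pat rows j == p)) (enum J) | p <- ps].

(** The successor in [r.+1] accounts for the entry of row [i] at the head of each pattern. *)
Lemma signatureP rows i r ps L :
    perm_eq (map (pat (i :: rows)) (enum J)) (expand L) ->
  signature L r.+1 ps = key (drop r rows) ps i.
Proof.
move=> LE; apply: eq_map => p.
rewrite -size_expand
  (expand_filter (fun q => if head false q then drop r.+1 q == p else false)).
rewrite size_filter -(permP LE) count_map; apply: eq_count => j /=.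
by rewrite /pat map_drop; case: (P i j).
Qed.

(** With the degree put in front of the key, one lexicographic comparison covers both the order by
    degree and the tie-break. *)
Lemma ex_min_row rows ps (rest : seq I) : rest != [::] ->
  exists2 i, i \in rest &
    {in rest, forall i', lexle (deg i :: key rows ps i) (deg i' :: key rows ps i')}.
Proof.
pose le i i' := lexle (deg i :: key rows ps i) (deg i' :: key rows ps i').
have le_tot : total le by move=> i i'; apply: lexle_total.
have le_tr : transitive le by move=> x y z; apply: lexle_trans.
have := sort_sorted le_tot rest; have := mem_sort le rest; have := size_sort le rest.
case: (sort le rest) => [|i s] sz srt /=; first by rewrite -size_eq0 -sz.
move=> /(order_path_min le_tr)/allP le_i _; exists i; first by rewrite -srt mem_head.
move=> i'; rewrite -srt inE => /predU1P[->|/le_i//].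
by have /orP[] := le_tot i i.
Qed.

(** At each level the row from [ex_min_row] yields a branch that passes all tests, so a matrix
    without rectangle and hole makes the search succeed. *)
Lemma searchP rows rest lo ps sg budget L :
    uniq (rows ++ rest) -> perm_eq (map (pat rows) (enum J)) (expand L) ->
    {in rest, forall i, lo <= deg i /\ (lo = deg i -> lexle sg (key (behead rows) ps i))} ->
    \sum_(i <- rest) deg i <= budget ->
  search (size rows) (size rest) lo ps sg budget L.
Proof.
move=> + LE; have [n sz] := ubnP (size rest).
elim: n rows rest lo ps sg budget L sz LE => // n IH rows rest lo ps sg budget L.
have [->//|rest0] := eqVneq rest [::].
have [i irest imin] := ex_min_row rows (unzip1 L) rest0.
set rest' := rem i rest; have rE : perm_eq rest (i :: rest') := perm_to_rem irest.
rewrite ltnS (perm_size rE) (perm_big _ rE) big_cons /= => sz LE u inv bud.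
rewrite (perm_uniq (perm_cat (perm_refl rows) rE)) (uniq_catCA rows [:: i] rest') in u.
have i_rows : i \notin rows.
  by move: u; rewrite /= mem_cat negb_or => /andP[/andP[]].
(* The least degree is at most the average. *)
have degi : deg i <= budget %/ (size rest').+1.
  rewrite leq_divRL // mulnS; apply: leq_trans bud; rewrite leq_add2l.
  rewrite -sum1_size big_distrr /= big_seq [leqRHS]big_seq; apply: leq_sum => i' i'r.
  rewrite muln1; have := imin i' (mem_rem i'r); rewrite /=.
  by case: eqP => [->|_ /ltnW].
have [s sE sL] := perm_map_exists LE.
have us : uniq s by rewrite (perm_uniq sE) enum_uniq.
have [||[d L'] dL' /= [dE L'E]] :=
  extensionsP (used := [::]) (cap := budget %/ (size rest').+1) i_rows us sL.
- by [].
- by rewrite (permP sE).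
rewrite (permP sE) -/(deg i) in dE.
have {}L'E : perm_eq (map (pat (i :: rows)) (enum J)) (expand L').
  by rewrite -(permPl (perm_map _ sE)).
apply/hasP; exists (d, L') => //; rewrite dE.
have [lo_le lo_eq] := inv i irest.
rewrite (signatureP 0 _ L'E) (signatureP 1 _ L'E) drop0 drop1.
(* Row [i] was still available when the last row was chosen, so it cannot precede that row in the
   order used then. *)
have -> : (if lo == deg i then lexle sg (key (behead rows) ps i) else lo < deg i).
  by case: eqP => [/lo_eq//|/eqP]; rewrite ltn_neqAle lo_le => ->.
(* The new row is one of the four, which leaves three to choose. *)
have -> : missed_le3 (size rows) 3 (avoid L').
  apply: (missed_le3P (D := [:: i]) (js := [seq j <- enum J | ~~ P i j])).
  - by move: u; rewrite catA cat_uniq => /andP[].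
  - by rewrite filter_uniq ?enum_uniq.
  - by [].
  - by move=> x j; rewrite inE mem_filter => /eqP-> /andP[].
  rewrite expand_forget (expand_filter (fun p => ~~ head true p)).
  have -> : [seq pat rows j | j <- [seq j <- enum J | ~~ P i j]] =
      map behead [seq p <- map (pat (i :: rows)) (enum J) | ~~ head true p].
    by rewrite filter_map -map_comp.
  exact/perm_map/perm_filter.
apply: (IH (i :: rows)) => //.
- move=> i' i'r; have := imin i' (mem_rem i'r); rewrite /=.
  by case: eqP => [-> //|_ lt]; split=> [|E]; [exact: ltnW | rewrite E ltnn in lt].
by rewrite leq_subRL // (leq_trans _ bud) ?leq_addr.
Qed.

End Completeness.

(** * The upper bound *)

Lemma arrows_9_14 : BR_arrows 9 14 (Kbip 2 2) (Kbip 4 4).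
Proof.
apply/(arrows_block (s := 2) (t := 4) 9 14 isT isT) => P.
have [//|no_rectangle] := boolP (block 2 P); apply: contraFT search_9_14 => no_hole.
have := @searchP _ _ P no_rectangle no_hole [::] (enum 'I_9) 0 [::] [::] 39 [:: ([::], 14)].
rewrite size_enum_ord enum_uniq; apply=> //.
  have sz : size [seq [::] : seq bool | _ <- enum 'I_14] = 14.
    by rewrite size_map size_enum_ord.
  suff -> : [seq [::] | _ <- enum 'I_14] = nseq 14 ([::] : seq bool) by [].
  by rewrite -[in RHS]sz; apply/all_pred1P/allP => _ /mapP[j _ ->].
(* The bound is [9 * 8 + 6 * 14 = 4 * 39]. *)
rewrite big_enum; have := sum_deg_le no_rectangle.
by rewrite !card_ord -[leqRHS]/(4 * 39) leq_pmul2l.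
Qed.

(** * The lower bound from the projective plane of order 3 *)

(* {0, 1, 3, 9} is a perfect difference set modulo 13. *)
Definition pg23 i j := (i + j) %% 13 \in [:: 0; 1; 3; 9].

(** A nonzero residue is the difference of exactly one ordered pair from the set. *)
Lemma pg23_lines_meet_once :
  all (fun i => all (fun i' => (i == i') ||
    (count (fun j => pg23 i j && pg23 i' j) (iota 0 13) < 2)) (iota 0 13)) (iota 0 13).
Proof. by vm_compute. Qed.

(** Four points in general position lie on [4 * 4 - 6 = 10] of the 13 lines in total; collinear
    triples only raise this number. *)
Lemma pg23_miss4 (I := iota 0 9) :
  all (fun a => all (fun b => all (fun c => all (fun d => uniq [:: a; b; c; d] ==>
    (count (fun j => all (fun i => ~~ pg23 i j) [:: a; b; c; d]) (iota 0 13) < 4))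
      I) I) I) I.
Proof. by vm_compute. Qed.

Lemma size_le_count_iota (p : pred nat) n (E : seq 'I_n) :
  uniq E -> {in E, forall j, p (val j)} -> size E <= count p (iota 0 n).
Proof.
move=> uE pE; rewrite -size_filter -(size_map val); apply: uniq_leq_size.
  by rewrite map_inj_uniq //; apply: val_inj.
by move=> _ /mapP[j jE ->]; rewrite mem_filter pE // mem_iota /=.
Qed.

Lemma not_arrows_9_le13 k : k <= 13 -> ~ BR_arrows 9 k (Kbip 2 2) (Kbip 4 4).
Proof.
move=> k_le13 /(arrows_block (s := 2) (t := 4) 9 k isT isT)/(_ (fun i j => pg23 i j)).
(* The first [k] lines serve as columns, and a block among them is a block among all thirteen. *)
have widen_inj : injective (widen_ord k_le13) by move=> x y [] /val_inj.
have idI : injective (@id 'I_9) by [].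
have mem9 (i : 'I_9) : val i \in iota 0 9 by rewrite mem_iota /=.
case/orP.
  move/(block_inj (P := fun (i : 'I_9) (j : 'I_13) => pg23 i j) idI widen_inj).
  case/blockP => -[|i [|i' [|? ?]]] [E [uD uE sD sE PDE]] //.
  have mem13 (x : 'I_9) : val x \in iota 0 13.
    by rewrite mem_iota /=; apply: leq_trans (ltn_ord x) _.
  have /allP/(_ _ (mem13 i))/allP/(_ _ (mem13 i')) := pg23_lines_meet_once.
  case/orP=> [/eqP/val_inj ii'|]; first by rewrite ii' /= inE eqxx in uD.
  rewrite ltnNge -{1}sE size_le_count_iota // => j jE.
  by rewrite !PDE ?inE ?eqxx ?orbT.
move/(block_inj (P := fun (i : 'I_9) (j : 'I_13) => ~~ pg23 i j) idI widen_inj).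
case/blockP => -[|a [|b [|c [|d [|? ?]]]]] [E [uD uE sD sE PDE]] //.
have /allP/(_ _ (mem9 a))/allP/(_ _ (mem9 b)) := pg23_miss4.
move=> /allP/(_ _ (mem9 c))/allP/(_ _ (mem9 d))/implyP.
have -> : uniq [:: val a; val b; val c; val d].
  by rewrite -(map_inj_uniq val_inj) in uD.
move=> /(_ isT); rewrite ltnNge -{1}sE size_le_count_iota // => j jE.
apply/allP=> x; rewrite -[[:: _; _; _; _]]/(map val [:: a; b; c; d]).
by case/mapP=> y yD ->; apply: PDE.
Qed.

Theorem theorem7 : BR_eq 9 (Kbip 2 2) (Kbip 4 4) 14.
Proof.
split=> [//||k _ arr]; first exact: arrows_9_14.
by rewrite leqNgt; apply/negP => k_lt14; apply: (@not_arrows_9_le13 k).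
Qed.
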